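(* For a Polish space $\mathcal{X}$, a separable Hilbert space $\mathcal{Y}$ and a separable reproducing kernel Hilbert space $\mathcal{H}\subset\mathcal{Y}^{\mathcal{X}}$ with operator-valued reproducing kernel $K$, consider the two conditions: (A) there is $\kappa>0$ such that $\|K(x,x)\|_{op}\le\kappa^2$ for all $x\in\mathcal{X}$; (B) $K$ is Hilbert-Schmidt (in the sense defined in the context) and $\sup_{x\in\mathcal{X}}\mathrm{Tr}(K(x,x))<+\infty$. Then: (i) (B) always implies (A); (ii) if $\dim\mathcal{Y}<\infty$, (A) and (B) are equivalent; (iii) when $\dim\mathcal{Y}=+\infty$ the converse of (i) is not true: there exist $\mathcal{X}$, an infinite-dimensional $\mathcal{Y}$, and $\mathcal{H}$ with kernel $K$ satisfying (A) but not (B).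
   Context: $L(\mathcal{Y})$ is the space of continuous linear endomorphisms of $\mathcal{Y}$ and $\|\cdot\|_{op}$ is the operator norm. $K:\mathcal{X}\times\mathcal{X}\to L(\mathcal{Y})$ is the (Hermitian, positive-definite) reproducing operator-valued kernel of $\mathcal{H}$ means: for all $x\in\mathcal{X}$, $y\in\mathcal{Y}$ the function $K(\cdot,x)y:x'\mapsto K(x',x)y$ belongs to $\mathcal{H}$; $\langle f(x),y\rangle_{\mathcal{Y}}=\langle f,K(\cdot,x)y\rangle_{\mathcal{H}}$ for all $f\in\mathcal{H}$, $x\in\mathcal{X}$, $y\in\mathcal{Y}$; $K(x_1,x_2)=K(x_2,x_1)^*$; and $\sum_{k,\ell=1}^n\langle K(x_k,x_\ell)y_\ell,y_k\rangle_{\mathcal{Y}}\ge0$ for all $n\ge1$, $x_1,\dots,x_n\in\mathcal{X}$, $y_1,\dots,y_n\in\mathcal{Y}$. Following the paper's terminology, $K$ is called Hilbert-Schmidt if for every $x\in\mathcal{X}$ there is an orthonormal basis $(y_i)_i$ of $\mathcal{Y}$ such that $\mathrm{Tr}(K(x,x))=\sum_i|\langle K(x,x)y_i,y_i\rangle_{\mathcal{Y}}|<\infty$. (Each $K(x,x)$ is a positive operator, so this sum does not depend on the orthonormal basis.) *)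

(* Defs.v *)
From HB Require Import structures.
From mathcomp Require Import all_boot all_order all_algebra.
From mathcomp Require Import complex.
From mathcomp Require Import all_classical all_reals all_analysis.

Set Implicit Arguments.
Unset Strict Implicit.
Unset Printing Implicit Defensive.

Import Order.TTheory GRing.Theory Num.Theory.
Import numFieldNormedType.Exports.

Local Open Scope classical_set_scope.
Local Open Scope ring_scope.

(* Hilbert spaces are real or complex: everything below is parameterized by the
   choice of the scalar field. *)
Variant scalar_kind := RealScalars | ComplexScalars.

Definition scalar_field (R : realType) (s : scalar_kind) : numFieldType :=
  match s with RealScalars => R | ComplexScalars => R[i] end.

Definition scalar_conj (R : realType) (s : scalar_kind) :
    scalar_field R s -> scalar_field R s :=
  match s with
  | RealScalars => fun x => x
  | ComplexScalars => fun z => z^*%C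
  end.

Definition scalar_re (R : realType) (s : scalar_kind) : scalar_field R s -> R :=
  match s with
  | RealScalars => fun x => x
  | ComplexScalars => fun z => complex.Re z
  end.

(* Norms take their values in the scalar field, as is the case for every
   normed module over it; this is the same norm, seen in R. *)
Definition rnorm (R : realType) (s : scalar_kind)
  (V : normedZmodType (scalar_field R s)) (x : V) : R := scalar_re `|x|.

(* The inner product is linear in its first argument and conjugate-linear in
   the second one. *)
HB.mixin Record NormedModule_hasInner (R : realType) (s : scalar_kind) V
    & NormedModule (scalar_field R s) V := {
  inner : {dot V for @scalar_conj R s} ;
  inner_norm : forall x : V, inner x x = `|x| ^+ 2 ;
}.

#[short(type="hilbertType")]
HB.structure Definition Hilbert (R : realType) (s : scalar_kind) :=
  {V of CompleteNormedModule (scalar_field R s) V & NormedModule_hasInner R s V}.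

Notation "'<[ u , v ]>" := (inner u v)
  (at level 0, u at level 99, v at level 99, format "''<[' u ,  v ]>")
  : ring_scope.

Definition separable (T : topologicalType) : Prop :=
  exists2 D : set T, countable D & dense D.

(* The completeness of M is not expressed by completePseudoMetricType because
   the latter excludes the empty space. *)
Definition polish (R : realType) (X : topologicalType) : Prop :=
  separable X /\
  exists (M : metricType R) (f : X -> M) (g : M -> X),
    [/\ cancel f g, cancel g f, continuous f, continuous g &
        forall F : set_system M, ProperFilter F -> cauchy F ->
          exists l : M, F --> l].

Section hilbert_space.
Context (R : realType) (s : scalar_kind) (Y : hilbertType R s).

Definition lspan (B : set Y) : set Y :=
  [set y | exists (n : nat) (c : 'I_n -> scalar_field R s) (v : 'I_n -> Y),
     (forall i, B (v i)) /\ y = \sum_(i < n) c i *: v i].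

Definition finite_dim : Prop :=
  exists2 B : set Y, finite_set B & lspan B = [set: Y].

(* A basis is given by the set of its vectors: an orthonormal family is
   injective, so that summing over the index set or over the range of the
   family is the same. *)
Definition orthonormal_basis (B : set Y) : Prop :=
  [/\ forall u, B u -> '<[u, u]> = 1,
      forall u v, B u -> B v -> u <> v -> '<[u, v]> = 0 &
      dense (lspan B)].

(* the space L(Y) *)
Record clin := CLin {
  clin_fun :> {linear Y -> Y} ;
  clin_continuous : continuous clin_fun }.

Definition opnorm (A : clin) : \bar R :=
  ereal_sup [set (rnorm (A y))%:E | y in [set y : Y | rnorm y <= 1]].

Definition abs_diag_sum (A : clin) (B : set Y) : \bar R :=
  \esum_(y in B) (scalar_re `|'<[A y, y]>|)%:E.

(* The trace of a positive operator, computed in some orthonormal basis (the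
   default value +oo is never used, as orthonormal bases exist); the result does
   not depend on the basis. *)
Definition trace (A : clin) : \bar R :=
  xget +oo%E [set abs_diag_sum A B | B in orthonormal_basis].

End hilbert_space.

Section reproducing_kernel.
Context (R : realType) (s : scalar_kind).

(* A Hilbert space of functions from X to Y is a Hilbert space H with an
   injective linear map ev to the space of all functions X -> Y. *)
Record is_rkhs (X : topologicalType) (Y H : hilbertType R s)
    (ev : {linear H -> (X -> Y)}) (K : X -> X -> clin Y) : Prop := {
  rkhs_polish : polish R X ;
  rkhs_separable_codomain : separable Y ;
  rkhs_separable : separable H ;
  rkhs_ev_inj : injective ev ;
  rkhs_reproducing : forall (x : X) (y : Y),
    exists2 k : H, ev k = (fun x' => K x' x y) &
      forall f : H, '<[ev f x, y]> = '<[f, k]> ;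
  rkhs_hermitian : forall (x1 x2 : X) (u v : Y),
    '<[K x2 x1 u, v]> = '<[u, K x1 x2 v]> ;
  rkhs_positive : forall (n : nat) (x : 'I_n -> X) (y : 'I_n -> Y),
    0 <= \sum_(k < n) \sum_(l < n) '<[K (x k) (x l) (y l), y k]> }.

Definition hilbert_schmidt (X : Type) (Y : hilbertType R s)
    (K : X -> X -> clin Y) : Prop :=
  forall x : X, exists2 B : set Y, orthonormal_basis B &
    trace (K x x) = abs_diag_sum (K x x) B /\
    (abs_diag_sum (K x x) B < +oo)%E.

Definition bounded_kernel (X : Type) (Y : hilbertType R s)
    (K : X -> X -> clin Y) : Prop :=
  exists2 kappa : R, 0 < kappa &
    forall x : X, (opnorm (K x x) <= (kappa ^+ 2)%:E)%E.

Definition bounded_trace_kernel (X : Type) (Y : hilbertType R s)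
    (K : X -> X -> clin Y) : Prop :=
  hilbert_schmidt K /\
  (ereal_sup [set trace (K x x) | x in [set: X]] < +oo)%E.

End reproducing_kernel.

(* Main.v *)
(** (B) implies (A): for a positive operator [A], the inequality
    [<A u, u> <= (sum_b <A b, b>) * |u|^2] holds on the span of an orthonormal
    basis, hence everywhere by density; the Cauchy-Schwarz inequality of the form
    [<A u, v>] at [v = A u] then bounds [|A u|] by the trace times [|u|].
    In dimension [n], every diagonal sum has at most [n] terms, each at most the
    operator norm.  In infinite dimension, the constant kernel equal to the
    identity of [l^2] has operator norm 1, and its diagonal sum is infinite in
    every orthonormal basis, as a finite one would make the space finite
    dimensional. *)
Require Import Defs.
From HB Require Import structures.
From mathcomp Require Import all_boot all_order all_algebra.
From mathcomp Require Import complex.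
From mathcomp Require Import all_classical all_reals all_analysis.
From mathcomp Require Import ring lra.

Set Implicit Arguments.
Unset Strict Implicit.
Unset Printing Implicit Defensive.

Import Order.TTheory GRing.Theory Num.Theory.
Import numFieldNormedType.Exports.

Local Open Scope classical_set_scope.
Local Open Scope ring_scope.

(** * The scalar field *)

Section scalars.
Context (R : realType) (s : scalar_kind).
Local Notation F := (scalar_field R s).
Local Notation conj := (@scalar_conj R s).
Local Notation re := (@scalar_re R s).
Implicit Types (z w : F) (r t : R).

(** Real and complex scalars are treated together: only facts about the scalar field itself split on
    [s]. Norms and diagonal entries are scalars, and the complex order is partial, so estimates are
    carried over to [R] through [rnorm] and [scalar_re]. The form ['<[A u, v]>] of a positive
    operator may be degenerate. Cauchy-Schwarz is therefore proved for semi-inner products, and then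
    serves this form, the inner product of [Y] and the one of l^2 alike. Only finite orthonormal
    families are ever expanded; the boundedness of [A] lets density carry the estimate to the whole
    space. Bounds relating a diagonal sum to the operator norm hold for every orthonormal basis,
    hence for whichever one [trace] selects; in finite dimension a basis must be exhibited, lest
    [trace] take its default value. A finite diagonal sum of the identity forces the basis to be
    finite; its span is then dense and, by orthogonal projection, the whole space. *)

Definition scalar_of : R -> F :=
  match s return R -> scalar_field R s with
  | RealScalars => fun x => x
  | ComplexScalars => fun x => x%:C%C
  end.

Lemma scalar_reD : {morph re : z w / z + w}.
Proof. by rewrite /scalar_re; case: s => //= -[a b] [c d]. Qed.

Lemma scalar_ofD : {morph scalar_of : r t / r + t}.
Proof. by rewrite /scalar_of; case: s => //= r t; rewrite rmorphD. Qed.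

Lemma scalar_ofM : {morph scalar_of : r t / r * t}.
Proof. by rewrite /scalar_of; case: s => //= r t; rewrite rmorphM. Qed.

Lemma scalar_ofK : cancel scalar_of re.
Proof. by rewrite /scalar_of /scalar_re; case: s. Qed.

Lemma scalar_of0 : scalar_of 0 = 0.
Proof. by rewrite /scalar_of; case: s. Qed.

Lemma scalar_re0 : re 0 = 0.
Proof. by rewrite /scalar_re; case: s. Qed.

Lemma scalar_re1 : re 1 = 1.
Proof. by rewrite /scalar_re; case: s. Qed.

Lemma scalar_of_le r t : (scalar_of r <= scalar_of t) = (r <= t).
Proof. by rewrite /scalar_of; case: s => //=; exact: lecR. Qed.

Lemma scalar_of_lt r t : (scalar_of r < scalar_of t) = (r < t).
Proof. by rewrite /scalar_of; case: s => //=; exact: ltcR. Qed.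

(** Together with [scalar_of_le], this turns inequalities between nonnegative scalars into real
    ones, where [lra] and [nra] apply. *)
Lemma scalar_reK z : 0 <= z -> scalar_of (re z) = z.
Proof.
rewrite /scalar_of /scalar_re; move: z; case: s => //= z z0.
by rewrite RRe_real ?ger0_real.
Qed.

Lemma scalar_ofN r : scalar_of (- r) = - scalar_of r.
Proof. by apply/eqP; rewrite -subr_eq0 opprK -scalar_ofD addNr scalar_of0. Qed.

Lemma scalar_conjD : {morph conj : z w / z + w}.
Proof. by rewrite /scalar_conj; case: s => //= z w; rewrite rmorphD. Qed.

Lemma scalar_conjM : {morph conj : z w / z * w}.
Proof. by rewrite /scalar_conj; case: s => //= z w; rewrite rmorphM. Qed.

Lemma scalar_conjN z : conj (- z) = - conj z.
Proof. by rewrite /scalar_conj; move: z; case: s => //= z; rewrite rmorphN. Qed.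

Lemma scalar_conj0 : conj 0 = 0.
Proof. by rewrite /scalar_conj; case: s => //=; exact: conjc0. Qed.

Lemma scalar_conjK : involutive conj.
Proof. by rewrite /scalar_conj; case: s => //= z; rewrite conjcK. Qed.

Lemma mul_scalar_conj z : z * conj z = `|z| ^+ 2.
Proof.
rewrite /scalar_conj; move: z; case: s => /= z.
  by rewrite real_normK ?num_real// expr2.
by rewrite sqr_normc.
Qed.

Lemma norm_scalar_conj z : `|conj z| = `|z|.
Proof. by rewrite /scalar_conj; move: z; case: s => //= z; rewrite normcJ. Qed.

Lemma scalar_conj_ge0 z : 0 <= z -> conj z = z.
Proof.
rewrite /scalar_conj; move: z; case: s => //= z z0.
by rewrite -[z]RRe_real ?ger0_real// conjc_real.
Qed.

Lemma scalar_re_conj z : re (conj z) = re z.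
Proof. by rewrite /scalar_re /scalar_conj; move: z; case: s => //= -[]. Qed.

Lemma scalar_re_norm z : re z <= rnorm z.
Proof.
rewrite /rnorm /scalar_re; move: z; case: s => /= z; first exact: ler_norm.
rewrite -lecR (RRe_real (normr_real z)).
by rewrite (le_trans _ (normc_ge_Re z))// lecR ler_norm.
Qed.

End scalars.

(** * The norm as a real number, and the topology it describes *)

Section rnorm.
Context (R : realType) (s : scalar_kind).
Local Notation F := (scalar_field R s).
Variable V : normedModType F.
Implicit Types (x y : V) (z w : F).

Lemma scalar_of_rnorm x : scalar_of s (rnorm x) = `|x|.
Proof. exact: scalar_reK. Qed.

Lemma rnorm_ge0 x : 0 <= rnorm x.
Proof. by rewrite -(scalar_of_le s) scalar_of0 scalar_of_rnorm. Qed.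

Lemma rnormD x y : rnorm (x + y) <= rnorm x + rnorm y.
Proof.
by rewrite -(scalar_of_le s) scalar_ofD !scalar_of_rnorm ler_normD.
Qed.

Lemma rnormZ z x : rnorm (z *: x) = rnorm z * rnorm x.
Proof.
by rewrite /rnorm normrZ -(scalar_ofK s (_ * _)) scalar_ofM !scalar_reK.
Qed.

Lemma rnorm0 : rnorm (0 : V) = 0.
Proof. by rewrite /rnorm normr0 -(scalar_of0 R s) scalar_ofK. Qed.

Lemma rnorm_eq0 x : rnorm x = 0 -> x = 0.
Proof.
by move=> x0; apply: normr0_eq0; rewrite -scalar_of_rnorm x0 scalar_of0.
Qed.

Lemma rnorm_distC x y : rnorm (x - y) = rnorm (y - x).
Proof. by rewrite /rnorm distrC. Qed.

Lemma rnorm_dist_le x y : `|rnorm x - rnorm y| <= rnorm (x - y).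
Proof.
have := rnormD (x - y) y; have := rnormD (y - x) x.
rewrite !subrK (rnorm_distC y) => h1 h2.
by rewrite ler_norml lerBrDr lerBlDr h2 andbT addrC lerBlDl.
Qed.

Lemma ball_rnorm x y (e : R) :
  ball x (scalar_of s e) y <-> rnorm (x - y) < e.
Proof. by rewrite -ball_normE /ball_ /= -scalar_of_rnorm scalar_of_lt. Qed.

(** The radius of a ball is a positive scalar, hence real even over the complex field, so real radii
    give the same neighbourhoods. *)
Lemma nbhs_rnorm x (A : set V) :
  nbhs x A <-> exists2 e : R, 0 < e & forall y, rnorm (x - y) < e -> A y.
Proof.
rewrite nbhs_ballP; split => [[e /= e0 eA]|[e e0 eA]].
  exists (scalar_re e) => [|y xy].
    by rewrite -(scalar_of_lt s) scalar_of0 scalar_reK// ltW.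
  by apply: eA; rewrite -(@scalar_reK _ _ e) ?ltW//; apply/ball_rnorm.
exists (scalar_of s e) => /= [|y /ball_rnorm]; last exact: eA.
by rewrite -(scalar_of0 R s) scalar_of_lt.
Qed.

Lemma cvg_rnormP (G : set_system V) (FG : Filter G) x :
  G --> x <-> forall e : R, 0 < e -> G [set y | rnorm (x - y) < e].
Proof.
split=> [Gx e e0|Gx A /nbhs_rnorm[e e0 eA]]; last exact: filterS (Gx e e0).
by apply: Gx; apply/nbhs_rnorm; exists e.
Qed.

Lemma cauchy_rnormP (G : set_system V) (FG : ProperFilter G) :
  cauchy G <-> forall e : R, 0 < e -> exists x, G [set y | rnorm (x - y) < e].
Proof.
rewrite cauchyP; split => [Gc e e0|Gc e e0].
  have [|x Gx] := Gc (scalar_of s e).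
    by rewrite -(scalar_of0 R s) scalar_of_lt.
  by exists x; apply: filterS Gx => y /ball_rnorm.
have [|x Gx] := Gc (scalar_re e).
  by rewrite -(scalar_of_lt s) scalar_of0 scalar_reK// ltW.
exists x; apply: filterS Gx => y /=.
by move=> xy; rewrite -(@scalar_reK _ _ e (ltW e0)); apply/ball_rnorm.
Qed.

End rnorm.

(** * Completeness of the scalar field *)

Section scalar_norm.
Context (R : realType) (s : scalar_kind).
Local Notation F := (scalar_field R s).
Implicit Types (z w : F).

Lemma rnormM z w : rnorm (z * w) = rnorm z * rnorm w.
Proof. exact: (@rnormZ R s F^o). Qed.

Lemma rnorm_conj z : rnorm (scalar_conj z) = rnorm z.
Proof. by rewrite /rnorm norm_scalar_conj. Qed.

Lemma rnorm_scalar_of (r : R) : rnorm (scalar_of s r) = `|r|.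
Proof.
rewrite /rnorm /scalar_of /scalar_re; case: s => [//|].
rewrite -[RHS]/(complex.Re (`|r|)%:C%C); congr complex.Re.
by rewrite normc_def /= expr0n addr0 sqrtr_sqr.
Qed.

Lemma rnorm_ge0_re z : 0 <= z -> rnorm z = scalar_re z.
Proof. by move=> z0; rewrite /rnorm ger0_norm. Qed.

Lemma complex_rnorm_le (z : scalar_field R ComplexScalars) :
  rnorm z <= `|complex.Re z| + `|complex.Im z|.
Proof.
rewrite -(scalar_of_le ComplexScalars).
rewrite (@scalar_of_rnorm R ComplexScalars (scalar_field R ComplexScalars)^o).
change (`|z : R[i]| <= (`|complex.Re z| + `|complex.Im z|)%:C%C).
rewrite [X in `|X|]complexE (le_trans (ler_normD _ _))// normrM !normc_def /=.
by rewrite !expr0n add0r !addr0 expr1n sqrtr1 mul1r !sqrtr_sqr -rmorphD.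
Qed.

(** In the complex case, real and imaginary parts are 1-Lipschitz, so they send [G] to Cauchy
    filters on [R]; the two real limits are the coordinates of the limit of [G]. *)
Lemma scalar_complete (G : set_system F) : ProperFilter G -> cauchy G -> cvg G.
Proof.
move: G; case: s => G PG; first exact: R_complete.
move=> Gc.
have {}Gc := (@cauchy_rnormP R ComplexScalars (R[i])^o G PG).1 Gc.
have nE (z : R[i]) : (@rnorm R ComplexScalars R[i] z)%:C%C = `|z|.
  by rewrite /rnorm /scalar_re RRe_real ?normr_real.
have part (p : R[i] -> R) :
    (forall z w : R[i], `|p z - p w| <= @rnorm R ComplexScalars R[i] (z - w)) ->
    cvg (p z @[z --> G]).
  move=> pL; apply: R_complete; apply/cauchyP => e e0.
  have [z Gz] := Gc e e0; exists (p z).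
  suff : G (p @^-1` ball (p z) e) by [].
  by apply: filterS Gz => w zw; exact: le_lt_trans (pL _ _) zw.
have Re_le (z w : R[i]) :
    `|complex.Re z - complex.Re w| <= @rnorm R ComplexScalars R[i] (z - w).
  rewrite -lecR nE.
  by rewrite (_ : _ - _ = complex.Re (z - w)) ?normc_ge_Re//; case: z w => [? ?] [].
have Im_le (z w : R[i]) :
    `|complex.Im z - complex.Im w| <= @rnorm R ComplexScalars R[i] (z - w).
  (* Multiplying by [-i], of modulus 1, turns the imaginary part into a real part. *)
  rewrite (_ : _ - _ = complex.Re ((z - w) * - 'i%C)); last first.
    by case: z w => [? ?] [? ?] /=; rewrite oppr0 mulr0 mulrN mulr1 opprK add0r.
  rewrite -lecR nE.
  rewrite (le_trans (normc_ge_Re _))// normrM normrN.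
  by rewrite (normc_def 'i%C) /= expr0n add0r expr1n sqrtr1 mulr1.
have /cvg_ex[a Ga] := part _ Re_le.
have /cvg_ex[b Gb] := part _ Im_le.
apply/cvg_ex; exists (a +i* b)%C.
apply/(@cvg_rnormP R ComplexScalars (R[i])^o) => e e0.
have e20 : 0 < e / 2 by rewrite divr_gt0.
move/cvgrPdist_lt : Ga => /(_ _ e20) Ga.
move/cvgrPdist_lt : Gb => /(_ _ e20) Gb.
near=> z.
apply: le_lt_trans (complex_rnorm_le _) _; rewrite (splitr e) ltrD//.
  rewrite (_ : complex.Re _ = a - complex.Re z); last by case: (z).
  by near: z.
rewrite (_ : complex.Im _ = b - complex.Im z); last by case: (z).
by near: z.
Unshelve. all: by end_near. Qed.

End scalar_norm.

(** * Inner products *)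

Section semi_inner_product.
Context (R : realType) (s : scalar_kind).
Local Notation F := (scalar_field R s).
Local Notation conj := (@scalar_conj R s).
Local Notation re := (@scalar_re R s).
Context (V : lmodType F) (f : V -> V -> F).
Hypothesis fDl : forall u v w, f (u + v) w = f u w + f v w.
Hypothesis fZl : forall a u w, f (a *: u) w = a * f u w.
Hypothesis fC : forall u v, f u v = conj (f v u).
Hypothesis f_ge0 : forall u, 0 <= f u u.

Lemma semi_innerDr u v w : f u (v + w) = f u v + f u w.
Proof. by rewrite fC fDl scalar_conjD -!fC. Qed.

Lemma semi_innerZr a u v : f u (a *: v) = conj a * f u v.
Proof. by rewrite fC fZl scalar_conjM -!fC. Qed.

Lemma semi_inner_cauchy_schwarz u v :
  rnorm (f u v) ^+ 2 <= re (f u u) * re (f v v).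
Proof.
suff : `|f u v| ^+ 2 <= f u u * f v v.
  rewrite -(scalar_of_rnorm (f u v : F^o)) -(scalar_reK (f_ge0 u)).
  rewrite -(scalar_reK (f_ge0 v)) expr2 -!scalar_ofM scalar_of_le.
  by rewrite !scalar_ofK expr2.
have conj_vv := scalar_conj_ge0 (f_ge0 v).
have [vv0|vv0] := eqVneq (f v v) 0; last first.
  (* This is the component of [u] orthogonal to [v], scaled by [f v v] to avoid a division; its form
     value is [f v v * (f u u * f v v - |f u v|^2)]. *)
  have := f_ge0 (f v v *: u + (- f u v) *: v).
  rewrite !(fDl, semi_innerDr, fZl, semi_innerZr) scalar_conjN conj_vv (fC v u).
  rewrite -mul_scalar_conj => h.
  have vv_gt0 : 0 < f v v by rewrite lt_def vv0 f_ge0.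
  rewrite -subr_ge0 -(pmulr_rge0 _ vv_gt0); apply: le_trans h _.
  by rewrite le_eqVlt; apply/orP; left; apply/eqP; ring.
(* When [f v v = 0], a multiple of [f u v *: v] large enough for
   [f (u - t f u v *: v) (u - t f u v *: v) = f u u - 2 t |f u v|^2] to be
   negative refutes [f u v <> 0]. *)
rewrite vv0 mulr0.
have [->|c0] := eqVneq (f u v) 0; first by rewrite normr0 expr0n.
have n_gt0 : 0 < `|f u v| ^+ 2 by rewrite exprn_gt0// normr_gt0.
set n := `|f u v| ^+ 2 in n_gt0 *.
pose t := (f u u + n) / n.
have t_ge0 : 0 <= t by rewrite divr_ge0 ?addr_ge0// ltW.
have := f_ge0 (u + (- (t * f u v)) *: v).
rewrite !(fDl, semi_innerDr, fZl, semi_innerZr) scalar_conjN scalar_conjM vv0.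
rewrite (scalar_conj_ge0 t_ge0) (fC v u) => h.
have : 0 <= f u u - (t * n) *+ 2.
  apply: le_trans h _; rewrite /n -mul_scalar_conj.
  by rewrite le_eqVlt; apply/orP; left; apply/eqP; ring.
rewrite divfK ?gt_eqF// => h'.
have : f u u + n *+ 2 <= 0.
  rewrite -oppr_ge0; apply: le_trans h' _.
  by rewrite le_eqVlt; apply/orP; left; apply/eqP; ring.
move=> h2; have : 0 < f u u + n *+ 2 by rewrite ltr_wpDl// pmulrn_lgt0.
by move=> /lt_le_trans/(_ h2); rewrite ltxx.
Qed.

Lemma semi_innerD_le u v :
  re (f (u + v) (u + v)) <= re (f u u) + re (f v v) + rnorm (f u v) *+ 2.
Proof.
rewrite fDl !semi_innerDr !scalar_reD (fC v u) scalar_re_conj.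
have := scalar_re_norm (f u v); lra.
Qed.

(** Squared form of the triangle inequality for the seminorm of [f], followed by Cauchy-Schwarz on
    the coefficients. For orthonormal [v i], the first factor becomes a partial trace and the second
    one a squared norm. *)
Lemma semi_inner_sum_le (I : Type) (r : seq I) (c : I -> F) (v : I -> V) :
  re (f (\sum_(i <- r) c i *: v i) (\sum_(i <- r) c i *: v i)) <=
  (\sum_(i <- r) re (f (v i) (v i))) * \sum_(i <- r) rnorm (c i) ^+ 2.
Proof.
have q_ge0 u : 0 <= re (f u u).
  by rewrite -(scalar_of_le s) scalar_of0 scalar_reK.
elim: r => [|i r IH].
  by rewrite !big_nil -(scale0r 0) fZl mul0r mul0r -(scalar_of0 R s) scalar_ofK.
rewrite !big_cons; set x := \sum_(_ <- r) _ in IH *.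
set a := re (f (v i) (v i)); set A := \sum_(j <- r) _ in IH *.
set C := \sum_(j <- r) rnorm _ ^+ 2 in IH *.
apply: le_trans (semi_innerD_le _ _) _.
have -> : re (f (c i *: v i) (c i *: v i)) = a * rnorm (c i) ^+ 2.
  rewrite fZl semi_innerZr mulrA mul_scalar_conj mulrC.
  rewrite -[in LHS](scalar_reK (f_ge0 (v i))) -(scalar_of_rnorm (c i : F^o)).
  by rewrite expr2 -!scalar_ofM scalar_ofK.
have := semi_inner_cauchy_schwarz (v i) x.
rewrite fZl rnormM.
have A0 : 0 <= A by apply: sumr_ge0.
have C0 : 0 <= C by apply: sumr_ge0 => j _; rewrite exprn_ge0// rnorm_ge0.
have := q_ge0 (v i); rewrite -/a.
have := @rnorm_ge0 R s F^o (c i); have := @rnorm_ge0 R s F^o (f (v i) x).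
set g := rnorm _; set d := rnorm (c i); set q := re (f x x) in IH *.
move=> g0 d0 a0 cs.
suff : d * g *+ 2 <= A * d ^+ 2 + a * C by nra.
(* AM-GM: [2 sqrt ((A d^2) (a C)) <= A d^2 + a C] *)
have h0 : 0 <= A * d ^+ 2 + a * C by rewrite addr_ge0// mulr_ge0// exprn_ge0.
rewrite -(@ler_pXn2r _ 2)// ?nnegrE//; last by rewrite mulrn_wge0// mulr_ge0.
have : g ^+ 2 <= a * (A * C) by apply: le_trans cs _; rewrite ler_wpM2l.
move=> /(ler_wpM2l (exprn_ge0 2 d0)) h.
have := sqr_ge0 (A * d ^+ 2 - a * C); nra.
Qed.

End semi_inner_product.

Section inner_product.
Context (R : realType) (s : scalar_kind) (Y : hilbertType R s).
Local Notation F := (scalar_field R s).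
Implicit Types (u v w : Y) (a : F).

Lemma innerDl u v w : '<[u + v, w]> = '<[u, w]> + '<[v, w]>.
Proof.
have := @zmod_morphisml_subproof _ _ _ _ _ _ (@inner R s Y) w u (- v).
have := @zmod_morphisml_subproof _ _ _ _ _ _ (@inner R s Y) w 0 v.
have := @zmod_morphisml_subproof _ _ _ _ _ _ (@inner R s Y) w 0 0.
by rewrite !sub0r oppr0 subrr opprK => -> ->; rewrite sub0r opprK.
Qed.

Lemma innerZl a u w : '<[a *: u, w]> = a * '<[u, w]>.
Proof. exact: (@linearl_subproof _ _ _ _ _ _ (@inner R s Y) w). Qed.

Lemma innerC u v : '<[u, v]> = scalar_conj '<[v, u]>.
Proof.
by have := @hermitian_subproof _ _ _ _ (@inner R s Y) u v; rewrite expr0 mul1r. Qed.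

Lemma inner_ge0 u : 0 <= '<[u, u]>.
Proof. by rewrite inner_norm exprn_ge0. Qed.

Lemma innerDr u v w : '<[u, v + w]> = '<[u, v]> + '<[u, w]>.
Proof. exact: semi_innerDr innerDl innerC u v w. Qed.

Lemma innerZr a u v : '<[u, a *: v]> = scalar_conj a * '<[u, v]>.
Proof. exact: semi_innerZr innerZl innerC a u v. Qed.

Lemma inner0l u : '<[0, u]> = 0.
Proof. by rewrite -(scale0r u) innerZl mul0r. Qed.

Lemma innerNl u v : '<[- u, v]> = - '<[u, v]>.
Proof. by rewrite -scaleN1r innerZl mulN1r. Qed.

Lemma inner_suml (I : Type) (r : seq I) (g : I -> Y) v :
  '<[\sum_(i <- r) g i, v]> = \sum_(i <- r) '<[g i, v]>.
Proof.
elim: r => [|i r IH]; first by rewrite !big_nil inner0l.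
by rewrite !big_cons innerDl IH.
Qed.

Lemma inner_sumr (I : Type) (r : seq I) (g : I -> Y) u :
  '<[u, \sum_(i <- r) g i]> = \sum_(i <- r) '<[u, g i]>.
Proof.
elim: r => [|i r IH]; first by rewrite !big_nil innerC inner0l scalar_conj0.
by rewrite !big_cons innerDr IH.
Qed.

Lemma re_inner_norm u : scalar_re '<[u, u]> = rnorm u ^+ 2.
Proof.
by rewrite inner_norm -(scalar_of_rnorm u) expr2 -scalar_ofM scalar_ofK expr2.
Qed.

Lemma inner_cauchy_schwarz u v : rnorm '<[u, v]> <= rnorm u * rnorm v.
Proof.
rewrite -(@ler_pXn2r _ 2)// ?nnegrE ?mulr_ge0 ?rnorm_ge0 ?(@rnorm_ge0 R s F^o)//.
rewrite exprMn -!re_inner_norm.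
exact: semi_inner_cauchy_schwarz innerDl innerZl innerC inner_ge0 u v.
Qed.

End inner_product.

(** * Orthonormal families *)

Section orthonormal_seq.
Context (R : realType) (s : scalar_kind) (Y : hilbertType R s).
Local Notation F := (scalar_field R s).
Implicit Types (u v y : Y) (o r : seq Y) (B : set Y).

Definition orthonormal_seq o :=
  uniq o /\ forall u v, u \in o -> v \in o -> '<[u, v]> = (u == v)%:R.

Lemma lspan_seqP r y : uniq r ->
  lspan [set` r] y -> exists c : Y -> F, y = \sum_(b <- r) c b *: b.
Proof.
move=> ur [n [c [v [vr ->]]]].
(* A combination in [lspan] may repeat vectors: the coefficient of [b] collects every [c i] with
   [v i = b]. *)
exists (fun b => \sum_(i < n) (v i == b)%:R * c i).
under [RHS]eq_bigr do rewrite scaler_suml.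
rewrite exchange_big; apply: eq_bigr => i _ /=.
rewrite (bigD1_seq (v i)) ?vr//= eqxx mul1r big1 ?addr0// => b bi.
by rewrite eq_sym (negbTE bi) mul0r scale0r.
Qed.

Lemma lspan_seq r (c : Y -> F) : lspan [set` r] (\sum_(b <- r) c b *: b).
Proof.
exists (size r), (fun i => c (tnth (in_tuple r) i)), (tnth (in_tuple r)).
by split=> [i|]; [exact: mem_tnth|rewrite big_tnth].
Qed.

Lemma lspan_finite B y : lspan B y ->
  exists r, [/\ uniq r, [set` r] `<=` B & lspan [set` r] y].
Proof.
move=> [n [c [v [vB ->]]]]; exists (undup [seq v i | i <- enum 'I_n]).
split; first exact: undup_uniq.
  by move=> b /=; rewrite mem_undup => /mapP[i _ ->].
exists n, c, v; split => // i /=; rewrite mem_undup map_f//.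
by rewrite mem_enum.
Qed.

Lemma lspan_mono B B' : B `<=` B' -> lspan B `<=` lspan B'.
Proof.
move=> BB y [n [c [v [vB ->]]]].
by exists n, c, v; split => // i; exact: BB.
Qed.

Lemma orthonormal_basis_seq B r : orthonormal_basis B ->
  uniq r -> [set` r] `<=` B -> orthonormal_seq r.
Proof.
move=> [B1 B0 _] ur rB; split=> // u v /rB uB /rB vB.
by have [<-|/eqP uv] := eqVneq u v; [rewrite B1|rewrite B0].
Qed.

Lemma inner_orthonormal_sum o (c : Y -> F) v : orthonormal_seq o -> v \in o ->
  '<[\sum_(b <- o) c b *: b, v]> = c v.
Proof.
move=> [uo oo] vo; rewrite inner_suml (bigD1_seq v)//= innerZl oo// eqxx mulr1.
rewrite big_seq_cond big1 ?addr0// => b /andP[bo bv].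
by rewrite innerZl oo// (negbTE bv) mulr0.
Qed.

Lemma orthonormal_expansion o y : orthonormal_seq o -> lspan [set` o] y ->
  y = \sum_(b <- o) '<[y, b]> *: b.
Proof.
move=> oo oy; have [c yc] := lspan_seqP oo.1 oy.
rewrite [LHS]yc; apply: eq_big_seq => b bo.
by rewrite [in RHS]yc inner_orthonormal_sum.
Qed.

Lemma orthonormal_parseval o y : orthonormal_seq o -> lspan [set` o] y ->
  rnorm y ^+ 2 = \sum_(b <- o) rnorm '<[y, b]> ^+ 2.
Proof.
move=> oo oy; rewrite -re_inner_norm {1}(orthonormal_expansion oo oy) inner_suml.
rewrite (big_morph (@scalar_re R s) (@scalar_reD R s) (id1 := 0)); last first.
  by rewrite -(scalar_of0 R s) scalar_ofK.
apply: eq_bigr => b _; rewrite innerZl (innerC b) mul_scalar_conj.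
by rewrite -(scalar_of_rnorm ('<[y, b]> : F^o)) expr2 -scalar_ofM scalar_ofK expr2.
Qed.

(** If [o] were longer than [r], the matrix of coordinates of [o] in [r] would have more rows than
    columns, hence a nonzero left kernel vector. This is a linear relation on [o], and inner
    products with the members of [o] make all its coefficients vanish. *)
Lemma orthonormal_seq_size o r : orthonormal_seq o -> lspan [set` r] = setT ->
  (size o <= size r)%N.
Proof.
move=> oo rT; rewrite leqNgt; apply/negP => ro.
have {}rT y : lspan [set` undup r] y.
  have : lspan [set` r] y by rewrite rT.
  by apply: lspan_mono => b /=; rewrite mem_undup.
have {ro} := leq_ltn_trans (size_undup r) ro.
have := undup_uniq r; move: (undup r) rT => {}r rT ur ro.
have /choice[c cE] y := lspan_seqP ur (rT y).
pose M := \matrix_(i < size o, j < size r) c (nth 0 o i) (nth 0 r j).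
have : kermx M != 0.
  rewrite kermx_eq0 /row_free neq_ltn; apply/orP; left.
  exact: leq_ltn_trans (rank_leq_col M) ro.
move=> /rowV0Pn[a /sub_kermxP aM a0]; move: a0 => /negP; apply.
apply/eqP/rowP => i; rewrite mxE.
(* The kernel vector, indexed by the vectors of [o] instead of their positions; the default 0 only
   concerns vectors outside [o]. *)
pose d b := if insub (index b o) is Some j then a 0 j else 0 : F.
have dE j : d (nth 0 o (val j)) = a 0 j :> F.
  rewrite /d index_uniq ?oo.1 ?ltn_ord//.
  by case: insubP => [k _ /val_inj -> //|]; rewrite ltn_ord.
suff sum0 : \sum_(b <- o) d b *: b = 0.
  have io : nth 0 o i \in o by rewrite mem_nth.
  by have := inner_orthonormal_sum d oo io; rewrite sum0 inner0l dE.
rewrite (big_nth 0) big_mkord.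
under eq_bigr => j _.
  rewrite dE [X in _ *: X]cE scaler_sumr.
  over.
rewrite exchange_big (big_nth 0) big_mkord big1// => k _.
under eq_bigr do rewrite scalerA.
rewrite -scaler_suml.
have := congr1 (fun N : 'rV_(size r) => N 0 k) aM; rewrite !mxE.
under eq_bigr do rewrite mxE.
by move=> ->; rewrite scale0r.
Qed.

Lemma dense_rnorm (S : set Y) y (e : R) : dense S -> 0 < e ->
  exists2 z, S z & rnorm (y - z) < e.
Proof.
move=> dS e0; pose U := [set z | rnorm (y - z) < e].
have yU : nbhs y U by apply/nbhs_rnorm; exists e.
have [|z [/interior_subset zU Sz]] := dS U° _ (open_interior _); first by exists y.
by exists z.
Qed.

(** The residual [w] of the orthogonal projection of [y] is orthogonal to the span. If it were
    nonzero, some [z] in the span would be closer to [y] than [rnorm w], whereas [|w|^2 =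
    '<[y - z, w]> <= |y - z| |w|]. *)
Lemma lspan_orthonormal_dense o : orthonormal_seq o ->
  dense (lspan [set` o]) -> lspan [set` o] = setT.
Proof.
move=> oo dO; apply/seteqP; split=> // y _.
pose w := y - \sum_(b <- o) '<[y, b]> *: b.
have wo z : lspan [set` o] z -> '<[z, w]> = 0.
  move=> oz; rewrite (orthonormal_expansion oo oz) inner_suml big_seq big1// => b bo.
  rewrite innerZl (innerC b w) /w innerDl innerNl inner_orthonormal_sum//.
  by rewrite subrr scalar_conj0 mulr0.
suff : rnorm w = 0.
  by move=> /rnorm_eq0/eqP; rewrite subr_eq0 => /eqP ->; exact: lspan_seq.
apply/eqP; rewrite eq_le rnorm_ge0 andbT leNgt; apply/negP => w0.
have [z zo yz] := dense_rnorm y dO w0.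
have : rnorm w ^+ 2 <= rnorm (y - z) * rnorm w.
  have -> : rnorm w ^+ 2 = rnorm '<[y - z, w]>.
    rewrite innerDl innerNl (wo _ zo) subr0.
    have -> : '<[y, w]> = '<[w, w]>.
      rewrite {2}/w innerDl innerNl.
      by rewrite (wo _ (lspan_seq o (fun b => '<[y, b]>))) subr0.
    by rewrite rnorm_ge0_re ?inner_ge0// re_inner_norm.
  exact: inner_cauchy_schwarz.
by rewrite expr2 ler_pM2r// leNgt yz.
Qed.

Lemma finite_dim_seq : finite_dim Y -> exists r : seq Y, lspan [set` r] = setT.
Proof. by move=> [B /finite_seqP[r ->] rT]; exists r. Qed.

(** Take an orthonormal sequence of maximal length, which exists because a generating sequence
    bounds the length. A vector outside its span would leave a nonzero residual whose normalization
    [e] extends the sequence. *)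
Lemma finite_dim_orthonormal_basis : finite_dim Y ->
  exists B, @orthonormal_basis R s Y B.
Proof.
move=> /finite_dim_seq[r rT].
pose P n := `[< exists2 o, orthonormal_seq o & size o = n >].
have P0 : exists n, P n by exists 0%N; apply/asboolP; exists [::].
have Pr n : P n -> (n <= size r)%N.
  by move=> /asboolP[ o oo <-]; exact: orthonormal_seq_size.
have [n /asboolP[ o oo <-] omax] := ex_maxnP P0 Pr.
exists [set` o]; have [uo o1] := oo; split.
- by move=> u uo'; rewrite o1// eqxx.
- by move=> u v uo' vo /eqP uv; rewrite o1// (negbTE uv).
suff -> : lspan [set` o] = setT by move=> U U0 _; rewrite setIT.
apply/seteqP; split=> // y _.
pose w := y - \sum_(b <- o) '<[y, b]> *: b.
have wo b : b \in o -> '<[w, b]> = 0.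
  by move=> bo; rewrite /w innerDl innerNl inner_orthonormal_sum// subrr.
have [/eqP|w0] := eqVneq w 0.
  by rewrite subr_eq0 => /eqP ->; exact: lspan_seq.
pose e := `|w|^-1 *: w.
have w_neq0 : `|w| != 0 :> F by rewrite normr_eq0.
have ee : '<[e, e]> = 1.
  rewrite innerZl innerZr inner_norm scalar_conj_ge0 ?invr_ge0//.
  by rewrite mulrA -expr2 -exprMn mulVf// expr1n.
have eo b : b \in o -> '<[e, b]> = 0 by move=> bo; rewrite innerZl wo// mulr0.
have e_notin : e \notin o.
  by apply/negP => /eo; rewrite ee => /eqP; rewrite oner_eq0.
have /omax : P (size (e :: o)).
  apply/asboolP; exists (e :: o) => //; split; first by rewrite /= e_notin.
  move=> u v; rewrite !inE => /predU1P[->|uo'] /predU1P[->|vo].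
  - by rewrite ee eqxx.
  - by rewrite eo//; case: eqP vo e_notin => // -> ->.
  - by rewrite innerC eo// scalar_conj0; case: eqP uo' e_notin => // -> ->.
  - exact: o1.
by rewrite /= ltnn.
Qed.

End orthonormal_seq.

(** * Trace and operator norm of a positive operator *)

Section positive_operators.
Context (R : realType) (s : scalar_kind) (Y : hilbertType R s).
Local Notation F := (scalar_field R s).
Implicit Types (u v y : Y) (o r : seq Y) (B : set Y).

Lemma clin_bounded (A : clin Y) :
  exists2 c : R, 0 <= c & forall y, rnorm (A y) <= c * rnorm y.
Proof.
have /linear_bounded_continuous/linear_boundedP := @clin_continuous _ _ _ A.
move=> /pinfty_ex_gt0[M M0 AM].
exists (scalar_re M) => [|y].
  by rewrite -(scalar_of_le s) scalar_of0 scalar_reK ltW.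
rewrite -(scalar_of_le s) scalar_ofM !scalar_of_rnorm (scalar_reK (ltW M0)).
exact: AM.
Qed.

Context (A : clin Y).
Hypothesis A_hermitian : forall u v, '<[A u, v]> = '<[u, A v]>.
Hypothesis A_ge0 : forall u, 0 <= '<[A u, u]>.
Local Notation q u := (scalar_re '<[A u, u]>).

Let formDl u v w : '<[A (u + v), w]> = '<[A u, w]> + '<[A v, w]>.
Proof. by rewrite linearD innerDl. Qed.

Let formZl (a : F) u w : '<[A (a *: u), w]> = a * '<[A u, w]>.
Proof. by rewrite linearZ innerZl. Qed.

Let formC u v : '<[A u, v]> = scalar_conj '<[A v, u]>.
Proof. by rewrite A_hermitian innerC. Qed.

Let form_cauchy_schwarz :=
  @semi_inner_cauchy_schwarz _ _ _ (fun u v => '<[A u, v]>)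
    formDl formZl formC A_ge0.

(** Apply [semi_inner_sum_le] to the expansion of [u] in finitely many vectors of [B]; by Parseval
    the squared coefficients add up to [rnorm u ^+ 2]. *)
Lemma quadratic_form_le_span B (T : R) : orthonormal_basis B ->
  (forall o, uniq o -> [set` o] `<=` B -> \sum_(b <- o) q b <= T) ->
  forall u, lspan B u -> q u <= T * rnorm u ^+ 2.
Proof.
move=> Bb BT u /lspan_finite[ o [uo oB ou]].
have oo := orthonormal_basis_seq Bb uo oB.
rewrite {1 2}(orthonormal_expansion oo ou) (orthonormal_parseval oo ou).
apply: le_trans.
  exact: (@semi_inner_sum_le _ _ _ (fun u v => '<[A u, v]>)
    formDl formZl formC A_ge0).
rewrite ler_wpM2r ?BT//.
by apply: sumr_ge0 => b _; rewrite exprn_ge0// (@rnorm_ge0 R s F^o).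
Qed.

(** A quantitative continuity argument: replacing [u] by a point of [S] at distance less than
    [d <= 1] costs at most [d * K], and [d] is arbitrarily small. *)
Lemma quadratic_form_le_dense (S : set Y) (T : R) : 0 <= T -> dense S ->
  (forall u, S u -> q u <= T * rnorm u ^+ 2) ->
  forall u, q u <= T * rnorm u ^+ 2.
Proof.
move=> T0 dS ST u; have [c c0 cA] := clin_bounded A.
set N := rnorm u; have N0 : 0 <= N := rnorm_ge0 u.
(* For [d <= 1], the three terms bound the coefficients of [d] in [T (N + d)^2 - T N^2], [c d^2] and
   [2 c (N + d) d], which come from [q z], [q (u - z)] and the cross term. *)
pose K := T * (2 * N + 1) + c + 2 * (c * (N + 1)).
have K0 : 0 <= K by rewrite /K !addr_ge0// !mulr_ge0// ?addr_ge0// ?mulr_ge0.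
suff step d : 0 < d -> d <= 1 -> q u <= T * N ^+ 2 + d * K.
  apply/ler_addgt0Pr => e e0.
  have K1 : 0 < K + 1 by rewrite ltr_wpDl.
  (* [K] may be zero, hence the denominator [K + 1]. *)
  pose d := Num.min 1 (e / (K + 1)).
  apply: le_trans (step d _ _) _.
  - by rewrite lt_min ltr01 divr_gt0.
  - by rewrite ge_min lexx.
  rewrite lerD2l (@le_trans _ _ (e / (K + 1) * K))//.
    by rewrite ler_wpM2r// ge_min lexx orbT.
  by rewrite -mulrA ler_piMr ?(ltW e0)// mulrC ler_pdivrMr// mul1r lerDl.
move=> d0 d1; have [z Sz uz] := dense_rnorm u dS d0.
have zN : rnorm z <= N + d.
  rewrite -[z](subrK u); apply: le_trans (rnormD _ _) _.
  by rewrite addrC lerD// rnorm_distC ltW.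
rewrite -[u](subrK z) addrC.
apply: le_trans.
  exact: (@semi_innerD_le _ _ _ (fun u v => '<[A u, v]>) formDl formC).
have h1 : q (u - z) <= c * d ^+ 2.
  apply: le_trans (scalar_re_norm _) _.
  apply: le_trans (inner_cauchy_schwarz _ _) _.
  apply: (@le_trans _ _ (c * rnorm (u - z) * rnorm (u - z))).
    by rewrite ler_wpM2r ?rnorm_ge0.
  by rewrite -mulrA -expr2 ler_wpM2l// ler_pXn2r ?nnegrE ?rnorm_ge0 ?ltW.
have h2 : rnorm '<[A z, u - z]> <= c * (N + d) * d.
  apply: le_trans (inner_cauchy_schwarz _ _) _.
  rewrite ler_pM ?rnorm_ge0 ?(ltW uz)//.
  by apply: le_trans (cA _) _; rewrite ler_wpM2l.
have h3 : q z <= T * (N + d) ^+ 2.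
  apply: le_trans (ST _ Sz) _.
  by rewrite ler_wpM2l// ler_pXn2r// nnegrE ?rnorm_ge0// addr_ge0// ltW.
apply: (@le_trans _ _ (T * (N + d) ^+ 2 + c * d ^+ 2 + (c * (N + d) * d) *+ 2)).
  by rewrite !lerD// lerMn2r.
have dd : d ^+ 2 <= d by rewrite expr2 ler_piMl// ltW.
have h4 := ler_wpM2l T0 dd; have h5 := ler_wpM2l c0 dd.
rewrite /K; nra.
Qed.

(** The bound on the form is used at [u] and at [A u]: [|A u|^4 <= q u * q (A u) <= T^2 |u|^2 |A
    u|^2], to be divided by [|A u|^2] when it is nonzero. *)
Lemma rnorm_le_quadratic_form (T : R) : 0 <= T ->
  (forall u, q u <= T * rnorm u ^+ 2) -> forall u, rnorm (A u) <= T * rnorm u.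
Proof.
move=> T0 qT u; have := form_cauchy_schwarz u (A u).
rewrite rnorm_ge0_re ?inner_ge0// re_inner_norm.
have qu := qT u; have qAu := qT (A u).
have q0 v : 0 <= q v by rewrite -(scalar_of_le s) scalar_of0 scalar_reK.
set n := rnorm (A u) in qAu *; set m := rnorm u in qu *.
have n0 : 0 <= n := rnorm_ge0 _; have m0 : 0 <= m := rnorm_ge0 _.
have [->|nz] := eqVneq n 0; first by rewrite mulr_ge0.
move=> h; have {}h : (n ^+ 2) ^+ 2 <= (T * m ^+ 2) * (T * n ^+ 2).
  by apply: le_trans h _; rewrite ler_pM.
have np : 0 < n ^+ 2 by rewrite exprn_gt0// lt_def nz.
rewrite -(@ler_pXn2r _ 2)// ?nnegrE ?mulr_ge0//.
rewrite -(ler_pM2r np) -expr2 (le_trans h)// le_eqVlt.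
by apply/orP; left; apply/eqP; ring.
Qed.

Lemma abs_diag_sum_ge B o : uniq o -> [set` o] `<=` B ->
  ((\sum_(b <- o) q b)%:E <= abs_diag_sum A B)%E.
Proof.
move=> uo oB; apply: esum_ge; exists [set` o].
  by split => //; apply/finite_seqP; exists o.
rewrite -fsbig_seq// sumEFin lee_fin; apply: ler_sum => b _.
exact: scalar_re_norm.
Qed.

Lemma rnorm_le_trace B (T : R) : 0 <= T -> orthonormal_basis B ->
  (abs_diag_sum A B <= T%:E)%E -> forall u, rnorm (A u) <= T * rnorm u.
Proof.
move=> T0 Bb BT; apply: rnorm_le_quadratic_form => //.
apply: (@quadratic_form_le_dense (lspan B)) => //; first by case: Bb.
apply: quadratic_form_le_span => // o uo oB.
by rewrite -lee_fin; apply: le_trans BT; exact: abs_diag_sum_ge.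
Qed.

Lemma opnorm_le_trace B (T : R) : 0 <= T -> orthonormal_basis B ->
  (abs_diag_sum A B <= T%:E)%E -> (opnorm A <= T%:E)%E.
Proof.
move=> T0 Bb BT; apply: ge_ereal_sup => _ [y y1 <-].
rewrite lee_fin; apply: le_trans (rnorm_le_trace T0 Bb BT y) _.
by rewrite ler_piMr.
Qed.

Lemma abs_diag_sum_ge0 B : (0 <= abs_diag_sum A B)%E.
Proof. by apply: esum_ge0 => y _; rewrite lee_fin (@rnorm_ge0 R s F^o). Qed.

(** The diagonal sum is a supremum of finite partial sums, so it is enough to bound the size of the
    finite parts of [B]; each entry satisfies [|'<[A b, b]>| <= |A b| <= k]. *)
Lemma abs_diag_sum_le_opnorm B (n : nat) (k : R) : 0 <= k ->
  orthonormal_basis B ->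
  (forall o, uniq o -> [set` o] `<=` B -> (size o <= n)%N) ->
  (opnorm A <= k%:E)%E -> (abs_diag_sum A B <= (k *+ n)%:E)%E.
Proof.
move=> k0 Bb Bn Ak; apply: ge_ereal_sup => _ [X [/finite_seqP[r Xr] XB] <-].
have Xu : X = [set` undup r].
  by rewrite Xr; apply/seteqP; split=> b; rewrite /= mem_undup.
rewrite Xu in XB *.
rewrite -fsbig_seq ?undup_uniq// sumEFin lee_fin.
apply: (@le_trans _ _ (\sum_(b <- undup r) k)).
  rewrite [leLHS]big_seq [leRHS]big_seq; apply: ler_sum => b bX.
  have b1 : rnorm b = 1.
    have /eqP : rnorm b ^+ 2 = 1.
      by have [B1 _ _] := Bb; rewrite -re_inner_norm (B1 _ (XB _ bX)) scalar_re1.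
    by rewrite sqrp_eq1 ?rnorm_ge0// => /eqP.
  apply: le_trans (inner_cauchy_schwarz _ _) _.
  rewrite b1 mulr1 -lee_fin; apply: le_trans Ak.
  by apply: ereal_sup_ubound; exists b; rewrite /= ?b1.
by rewrite big_const_seq count_predT iter_addr_0 ler_wpMn2l ?Bn// undup_uniq.
Qed.

End positive_operators.

(** * The two implications between the conditions on the kernel *)

Section kernels.
Context (R : realType) (s : scalar_kind).
Context (X : topologicalType) (Y H : hilbertType R s).
Context (ev : {linear H -> (X -> Y)}) (K : X -> X -> clin Y).
Hypothesis rkhsK : is_rkhs ev K.

Let K_hermitian x u v : '<[K x x u, v]> = '<[u, K x x v]>.
Proof. exact: (rkhs_hermitian rkhsK). Qed.

Let K_ge0 x u : 0 <= '<[K x x u, u]>.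
Proof.
have := rkhs_positive rkhsK (fun=> x : X) (fun=> u) (n := 1).
by rewrite !big_ord1.
Qed.

Lemma bounded_trace_kernel_bounded : bounded_trace_kernel K -> bounded_kernel K.
Proof.
move=> [HS]; set S := ereal_sup _ => Soo.
(* [T] serves as [kappa]: being at least 1, it satisfies [T <= T ^+ 2]. The supremum can be [-oo],
   namely when [X] is empty. *)
have [T [T1 ST]] : exists T : R, 1 <= T /\ (S <= T%:E)%E.
  case: S Soo => [r _|//|_]; last by exists 1; rewrite leNye.
  by exists (Num.max 1 r); rewrite lee_fin !le_max !lexx orbT.
have T0 : 0 < T := lt_le_trans ltr01 T1.
exists T => // x.
have [B Bb [BT _]] := HS x.
have BT' : (abs_diag_sum (K x x) B <= T%:E)%E.
  by rewrite -BT; apply: le_trans ST; apply: ereal_sup_ubound; exists x.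
apply: le_trans (opnorm_le_trace (K_hermitian x) (K_ge0 x) (ltW T0) Bb BT') _.
by rewrite lee_fin expr2 ler_peMl// ltW.
Qed.

Lemma finite_dim_bounded_trace_kernel :
  finite_dim Y -> bounded_kernel K -> bounded_trace_kernel K.
Proof.
move=> fY [k k0 Kk]; have [r rT] := finite_dim_seq fY.
have [B0 B0b] := finite_dim_orthonormal_basis fY.
have bound x B : orthonormal_basis B ->
    (abs_diag_sum (K x x) B <= (k ^+ 2 *+ size r)%:E)%E.
  move=> Bb; apply: abs_diag_sum_le_opnorm => //; first exact: sqr_ge0.
  move=> o uo oB; apply: orthonormal_seq_size rT.
  exact: orthonormal_basis_seq oB.
(* The basis [B0] shows that the set from which [trace] chooses is nonempty, which excludes the
   default value [+oo]. *)
have traceP x :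
    exists2 B, orthonormal_basis B & trace (K x x) = abs_diag_sum (K x x) B.
  rewrite /trace; case: xgetP => [y -> [B Bb <-]|/(_ (abs_diag_sum (K x x) B0)) []].
    by exists B.
  by exists B0.
split=> [x|].
  have [B Bb BT] := traceP x; exists B => //; split => //.
  exact: le_lt_trans (bound x B Bb) (ltry _).
apply: (@le_lt_trans _ _ (k ^+ 2 *+ size r)%:E); last exact: ltry.
by apply: ge_ereal_sup => _ [x _ <-]; have [B Bb ->] := traceP x; exact: bound.
Qed.

End kernels.

(** * The Hilbert space of square-summable sequences *)

Section square_summable.
Context (R : realType) (s : scalar_kind).
Local Notation F := (scalar_field R s).
Local Notation conj := (@scalar_conj R s).
Implicit Types (u v w : nat -> F) (n : nat).

Definition sqsum u n : R := \sum_(k < n) rnorm (u k) ^+ 2.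

Definition square_summable : {pred nat -> F} :=
  [pred u | `[< exists M : R, forall n, sqsum u n <= M >]].

Lemma square_summableP u :
  reflect (exists M : R, forall n, sqsum u n <= M) (u \in square_summable).
Proof. by rewrite inE; exact: asboolP. Qed.

Lemma square_summable_submod : submod_closed square_summable.
Proof.
split=> [|a u v /square_summableP[M uM] /square_summableP[N vN]].
  apply/square_summableP; exists 0 => n; rewrite /sqsum big1// => k _.
  by rewrite (@rnorm0 R s F^o) expr0n.
apply/square_summableP.
(* From [|a u + v|^2 <= 2 |a u|^2 + 2 |v|^2] in each coordinate. *)
exists (2 * (rnorm a ^+ 2 * M) + 2 * N) => n.
apply: (@le_trans _ _ (2 * (rnorm a ^+ 2 * sqsum u n) + 2 * sqsum v n)).
  rewrite /sqsum !mulr_sumr -big_split; apply: ler_sum => k _ /=.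
  have := @rnormD R s F^o (a * u k) (v k); rewrite rnormM.
  have -> : (a *: u + v) k = a * u k + v k by [].
  have := @rnorm_ge0 R s F^o (a * u k + v k).
  set x := rnorm (a * u k + v k); set y := rnorm a * _; set z := rnorm (v k).
  rewrite -exprMn -/y => x0 xyz; have := sqr_ge0 (y - z).
  have : x ^+ 2 <= (y + z) ^+ 2 by rewrite ler_pXn2r// nnegrE// (le_trans x0).
  nra.
by rewrite lerD// ler_wpM2l// ler_wpM2l// exprn_ge0// (@rnorm_ge0 R s F^o).
Qed.

HB.instance Definition _ :=
  GRing.isSubmodClosed.Build F (nat -> F) square_summable square_summable_submod.

Record ell2 := Ell2 { ell2_fun :> nat -> F ; _ : ell2_fun \in square_summable }.

HB.instance Definition _ := [isSub for ell2_fun].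
HB.instance Definition _ := [Choice of ell2 by <:].
HB.instance Definition _ := [SubChoice_isSubLmodule of ell2 by <:].

Lemma ell2B (u v : ell2) k : (u - v) k = u k - v k.
Proof. by []. Qed.

Lemma sqsum_mono u : {homo sqsum u : m n / (m <= n)%N >-> m <= n}.
Proof.
apply: homo_leq => [//|? ? ?|n]; first exact: le_trans.
by rewrite /sqsum big_ord_recr/= lerDl exprn_ge0// (@rnorm_ge0 R s F^o).
Qed.

Lemma sqsum_cvg (u : ell2) : cvgn (sqsum u).
Proof.
have /square_summableP[M uM] := valP u.
apply: nondecreasing_is_cvgn; first exact: sqsum_mono.
by exists M => _ [n _ <-]; exact: uM.
Qed.

(** The increments of [a] are controlled by those of a convergent real sequence, so [a] is Cauchy: a
    comparison test for scalar series. *)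
Lemma cvgn_dominated (a : nat -> F) (g : nat -> R) : cvgn g ->
  (forall m n, (m <= n)%N -> rnorm (a n - a m) <= g n - g m) -> cvgn a.
Proof.
move=> /cvg_ex[l /cvgrPdist_lt gl] ag; apply: scalar_complete.
apply/(@cauchy_rnormP R s F^o) => e e0.
have [N _ gN] := gl _ (divr_gt0 e0 (ltr0Sn R 1)).
exists (a N); change (\forall n \near \oo, rnorm (a N - a n) < e); near=> n.
have Nn : (N <= n)%N by near: n; exact: nbhs_infty_ge.
rewrite (@rnorm_distC R s F^o); apply: le_lt_trans (ag _ _ Nn) _.
have := gN _ (leqnn N); have := gN _ Nn; rewrite /= !ltr_norml.
move=> /andP[h1 h2] /andP[h3 h4].
lra.
Unshelve. all: by end_near. Qed.

Definition inner_psum u v n : F := \sum_(k < n) u k * conj (v k).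

Definition ell2_inner (u v : ell2) : F := limn (inner_psum u v).

Lemma inner_psum_cvg (u v : ell2) : inner_psum u v @ \oo --> ell2_inner u v.
Proof.
(* Each new term satisfies [|u n * conj (v n)| <= |u n|^2 + |v n|^2]. *)
apply: (@cvgn_dominated _ (fun n => sqsum u n + sqsum v n)).
  by apply: is_cvgD; exact: sqsum_cvg.
move=> m n; elim: n => [|n IH].
  by rewrite leqn0 => /eqP ->; rewrite !subrr (@rnorm0 R s F^o).
rewrite leq_eqVlt => /predU1P[->|]; first by rewrite !subrr (@rnorm0 R s F^o).
rewrite ltnS => /IH {}IH.
rewrite /inner_psum /sqsum !big_ord_recr/= -!/(sqsum _ _) -!/(inner_psum _ _ _).
rewrite addrAC; apply: le_trans (@rnormD R s F^o _ _) _.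
rewrite rnormM rnorm_conj.
move: IH; set x := rnorm (u n); set y := rnorm (v n).
have := sqr_ge0 (x - y); have := sqr_ge0 (x + y); nra.
Qed.

Let F_hausdorff : hausdorff_space F.
Proof. exact: (@norm_hausdorff F F^o). Qed.

Lemma ell2_innerDl (u v w : ell2) :
  ell2_inner (u + v) w = ell2_inner u w + ell2_inner v w.
Proof.
apply/cvg_lim => //.
rewrite (_ : inner_psum _ _ = inner_psum u w \+ inner_psum v w); last first.
  apply/funext => n; rewrite /inner_psum /= -big_split.
  by apply: eq_bigr => k _; exact: mulrDl.
by apply: (@cvgD _ F^o); exact: inner_psum_cvg.
Qed.

Lemma ell2_innerZl a (u w : ell2) : ell2_inner (a *: u) w = a * ell2_inner u w.
Proof.
apply/cvg_lim => //.
rewrite (_ : inner_psum _ _ = (fun n => a * inner_psum u w n)); last first.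
  apply/funext => n; rewrite /inner_psum /= mulr_sumr.
  by apply: eq_bigr => k _; rewrite mulrA.
by apply: cvgM; [exact: cvg_cst|exact: inner_psum_cvg].
Qed.

Lemma ell2_innerC (u v : ell2) : ell2_inner u v = conj (ell2_inner v u).
Proof.
apply/cvg_lim => //; apply/(@cvg_rnormP R s F^o) => e e0.
have h : \forall n \near \oo, rnorm (ell2_inner v u - inner_psum v u n) < e.
  exact: ((@cvg_rnormP R s F^o _ _ _).1 (@inner_psum_cvg v u)).
change (\forall n \near \oo,
  rnorm (conj (ell2_inner v u) - inner_psum u v n) < e).
apply: filterS h => n.
rewrite -[X in X < _ -> _]rnorm_conj scalar_conjD scalar_conjN.
suff -> : conj (inner_psum v u n) = inner_psum u v n by [].
rewrite /inner_psum (big_morph conj (@scalar_conjD R s) (scalar_conj0 R s)).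
by apply: eq_bigr => k _; rewrite scalar_conjM scalar_conjK mulrC.
Qed.

Lemma ell2_inner_sq (u : ell2) : ell2_inner u u = scalar_of s (limn (sqsum u)).
Proof.
apply/cvg_lim => //; apply/(@cvg_rnormP R s F^o) => e e0.
have /cvgrPdist_lt/(_ _ e0) h := @sqsum_cvg u.
change (\forall n \near \oo,
  rnorm (scalar_of s (limn (sqsum u)) - inner_psum u u n) < e).
apply: filterS h => n.
suff -> : inner_psum u u n = scalar_of s (sqsum u n).
  by rewrite -scalar_ofN -scalar_ofD rnorm_scalar_of.
rewrite /inner_psum (big_morph (@scalar_of R s) (@scalar_ofD R s) (scalar_of0 R s)).
apply: eq_bigr => k _; rewrite mul_scalar_conj expr2 scalar_ofM.
by rewrite (@scalar_of_rnorm R s F^o) -expr2.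
Qed.

End square_summable.

(** * Norm, completeness and inner product of the sequence space *)

Section ell2_hilbert.
Context (R : realType) (s : scalar_kind).
Local Notation F := (scalar_field R s).
Local Notation conj := (@scalar_conj R s).
Local Notation E := (ell2 R s).
Implicit Types u v w : E.

Let sq u : R := limn (sqsum u).

Let sqsum_le_lim u n : sqsum u n <= sq u.
Proof.
by apply: nondecreasing_cvgn_le; [exact: sqsum_mono|exact: sqsum_cvg].
Qed.

Let sq_ge0 u : 0 <= sq u.
Proof. by apply: le_trans (sqsum_le_lim u 0); rewrite /sqsum big_ord0. Qed.

Let ell2_inner_ge0 u : 0 <= ell2_inner u u.
Proof. by rewrite ell2_inner_sq -(scalar_of0 R s) scalar_of_le sq_ge0. Qed.

Let re_ell2_inner u : scalar_re (ell2_inner u u) = sq u.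
Proof. by rewrite ell2_inner_sq scalar_ofK. Qed.

Let sq_eq0 u : sq u = 0 -> u = 0.
Proof.
move=> u0; apply/val_inj/funext => k.
apply: (@rnorm_eq0 R s F^o); apply/eqP; rewrite -sqrf_eq0 eq_le sqr_ge0 andbT.
rewrite -u0; apply: le_trans (sqsum_le_lim u k.+1).
rewrite /sqsum big_ord_recr/= lerDr; apply: sumr_ge0 => i _; exact: sqr_ge0.
Qed.

Definition ell2_norm u : F := scalar_of s (Num.sqrt (sq u)).

Let ell2_normD u v : ell2_norm (u + v) <= ell2_norm u + ell2_norm v.
Proof.
rewrite -scalar_ofD scalar_of_le.
have a0 := sqrtr_ge0 (sq u); have b0 := sqrtr_ge0 (sq v).
have au := sqr_sqrtr (sq_ge0 u); have bv := sqr_sqrtr (sq_ge0 v).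
rewrite -[leRHS]ger0_norm ?addr_ge0// -sqrtr_sqr ler_sqrt ?sqr_ge0//.
have := semi_innerD_le (@ell2_innerDl R s) (@ell2_innerC R s) u v.
have := semi_inner_cauchy_schwarz (@ell2_innerDl R s) (@ell2_innerZl R s)
  (@ell2_innerC R s) ell2_inner_ge0 u v.
rewrite !re_ell2_inner -{1}au -{1}bv -exprMn.
rewrite ler_pXn2r ?nnegrE ?mulr_ge0 ?(@rnorm_ge0 R s F^o)// => h1 h2.
apply: le_trans h2 _; rewrite -{1}au -{1}bv; nra.
Qed.

Let ell2_normZ (a : F) u : ell2_norm (a *: u) = `|a| * ell2_norm u.
Proof.
rewrite /ell2_norm -(@scalar_of_rnorm R s F^o) -scalar_ofM; congr scalar_of.
rewrite -[X in X * _]ger0_norm ?(@rnorm_ge0 R s F^o)// -sqrtr_sqr -sqrtrM ?sqr_ge0//.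
congr Num.sqrt.
rewrite -!re_ell2_inner ell2_innerZl.
rewrite (semi_innerZr (@ell2_innerZl R s) (@ell2_innerC R s)).
rewrite mulrA mul_scalar_conj ell2_inner_sq -(@scalar_of_rnorm R s F^o).
by rewrite expr2 -!scalar_ofM !scalar_ofK -expr2.
Qed.

Let ell2_norm0_eq0 u : ell2_norm u = 0 -> u = 0.
Proof.
move=> /(congr1 (@scalar_re R s)); rewrite scalar_ofK scalar_re0 => /eqP.
by rewrite sqrtr_eq0 => u0; apply: sq_eq0; apply/eqP; rewrite eq_le u0 sq_ge0.
Qed.

HB.instance Definition _ :=
  Lmodule_isNormed.Build F E ell2_normD ell2_normZ ell2_norm0_eq0.

Lemma rnorm_ell2 u : rnorm u = Num.sqrt (limn (sqsum u)).
Proof. by rewrite /rnorm [`|u|]/(ell2_norm u) scalar_ofK. Qed.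

Lemma sqsum_le_rnorm u n : sqsum u n <= rnorm u ^+ 2.
Proof. by rewrite rnorm_ell2 sqr_sqrtr ?sq_ge0. Qed.

Lemma rnorm_ell2_le u (c : R) : 0 <= c ->
  (forall n, sqsum u n <= c ^+ 2) -> rnorm u <= c.
Proof.
move=> c0 uc; rewrite rnorm_ell2 -[leRHS]ger0_norm// -sqrtr_sqr ler_sqrt ?sqr_ge0//.
by apply: limr_le; [exact: sqsum_cvg|apply: nearW => n; exact: uc].
Qed.

Lemma rnorm_coord_le u k : rnorm (u k) <= rnorm u.
Proof.
rewrite -(@ler_pXn2r _ 2)// ?nnegrE ?rnorm_ge0 ?(@rnorm_ge0 R s F^o)//.
apply: le_trans (sqsum_le_rnorm u k.+1).
by rewrite /sqsum big_ord_recr/= lerDr; apply: sumr_ge0 => i _; exact: sqr_ge0.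
Qed.

(** Coordinates converge along [G] to some [l]. If [G]-most points are within [e] of [x], the bound
    [e ^+ 2] on [sqsum (x - y) n] passes to the limit for each fixed [n], a finite sum; it is
    uniform in [n] and thus bounds the distance from [x] to [l]. *)
Lemma ell2_complete (G : set_system E) : ProperFilter G -> cauchy G -> cvg G.
Proof.
move=> PG /cauchy_rnormP Gc.
have coord k : cvg ((fun u : E => u k) @ G).
  apply: scalar_complete; apply/(@cauchy_rnormP R s F^o) => e e0.
  have [x Gx] := Gc e e0; exists (x k).
  change (G [set y : E | rnorm (x k - y k) < e]).
  by apply: filterS Gx => y; apply: le_lt_trans; exact: (rnorm_coord_le (x - y)).
pose l k : F := lim ((fun u : E => u k) @ G).
have coord_l k : (fun u : E => u k) @ G --> l k by exact: coord.
have sq_l (x : E) (e : R) : 0 < e -> G [set y | rnorm (x - y) < e] ->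
    forall n, sqsum (fun k => x k - l k) n <= e ^+ 2.
  move=> e0 Gx n.
  have cvg_sq : (fun y : E => sqsum (x - y : E) n) @ G -->
      sqsum (fun k => x k - l k) n.
    rewrite /sqsum; elim: n => [|n IH].
      by under eq_fun do rewrite big_ord0; rewrite big_ord0; exact: cvg_cst.
    under eq_fun do rewrite big_ord_recr; rewrite big_ord_recr.
    apply: cvgD => //.
    suff h : (fun y : E => rnorm (x n - y n)) @ G --> rnorm (x n - l n).
      by apply: cvgM.
    apply/cvgrPdist_lt => d d0.
    have := (@cvg_rnormP R s F^o _ _ _).1 (coord_l n) d d0.
    move=> h; have {}h : G [set y : E | rnorm (l n - y n) < d] by exact: h.
    apply: filterS h => y; apply: le_lt_trans.
    apply: le_trans (@rnorm_dist_le R s F^o _ _) _.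
    by rewrite opprB addrC addrA subrK rnorm_distC.
  rewrite leNgt; apply/negP => h.
  have : G [set y : E | e ^+ 2 < sqsum (x - y : E) n].
    exact: cvgr_gt cvg_sq _ h.
  move=> h'; have [y [h1 h2]] := filter_ex (filterI h' Gx).
  have h3 : sqsum (x - y : E) n <= e ^+ 2.
    apply: le_trans (sqsum_le_rnorm _ _) _.
    by rewrite ler_pXn2r ?nnegrE ?rnorm_ge0// ltW.
  by have := lt_le_trans h1 h3; rewrite ltxx.
have [x0 Gx0] := Gc 1 ltr01.
(* The estimate controls [x0 - l] rather than [l], so [l] is written as a difference of two
   square-summable sequences. *)
have l_sum : (fun k => x0 k - (x0 k - l k)) \in @square_summable R s.
  have d_sum : (fun k => x0 k - l k) \in @square_summable R s.
    by apply/square_summableP; exists (1 ^+ 2); exact: sq_l.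
  exact: rpredB (valP x0) d_sum.
pose L : E := Ell2 l_sum.
have LE k : L k = l k by rewrite /= opprB addrC subrK.
apply/cvg_ex; exists L; apply/cvg_rnormP => e e0.
(* The limit gives only [|x - L| <= e / 2]; strictness comes from [|x - y| < e / 2]. *)
have e20 : 0 < e / 2 by rewrite divr_gt0.
have [x Gx] := Gc _ e20.
have xL : rnorm (x - L) <= e / 2.
  apply: rnorm_ell2_le => [|n]; first exact: ltW.
  rewrite [sqsum _ _](_ : _ = sqsum (fun k => x k - l k) n); first exact: sq_l.
  by apply: eq_bigr => k _; rewrite ell2B LE.
apply: filterS Gx => y /= xy.
rewrite -[L - y](_ : (L - x) + (x - y) = _); last by rewrite addrA subrK.
by apply: le_lt_trans (rnormD _ _) _; rewrite [ltRHS]splitr ler_ltD// rnorm_distC.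
Qed.

HB.instance Definition _ := Uniform_isComplete.Build E ell2_complete.

Let ell2_inner_zmodl v : zmod_morphism (@ell2_inner R s ^~ v).
Proof. by move=> u w; rewrite -[- w]scaleN1r ell2_innerDl ell2_innerZl mulN1r. Qed.

Let ell2_inner_zmodr u : zmod_morphism (@ell2_inner R s u).
Proof.
move=> v w; rewrite ell2_innerC ell2_inner_zmodl scalar_conjD scalar_conjN.
by rewrite -!ell2_innerC.
Qed.

Let ell2_inner_scalel v : scalable_for *%R (@ell2_inner R s ^~ v).
Proof. by move=> a u; rewrite ell2_innerZl. Qed.

Let ell2_inner_scaler u : scalable_for (conj \; *%R) (@ell2_inner R s u).
Proof.
by move=> a v; rewrite /= ell2_innerC ell2_innerZl scalar_conjM -ell2_innerC.
Qed.

HB.instance Definition _ := @isBilinear.Build F E E F *%R (conj \; *%R)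
  (@ell2_inner R s) ell2_inner_zmodl ell2_inner_zmodr ell2_inner_scalel
  ell2_inner_scaler.

Let ell2_inner_hermitian u v :
  ell2_inner u v = (-1) ^+ false * conj (ell2_inner v u).
Proof. by rewrite expr0 mul1r ell2_innerC. Qed.

HB.instance Definition _ := @isHermitianSesquilinear.Build F E false conj
  (@ell2_inner R s) ell2_inner_hermitian.

Let ell2_inner_gt0 u : u != 0 -> 0 < ell2_inner u u.
Proof.
move=> u0; rewrite lt_def ell2_inner_ge0 andbT; apply: contra u0 => /eqP uu0.
by apply/eqP/sq_eq0; rewrite -re_ell2_inner uu0 scalar_re0.
Qed.

HB.instance Definition _ := @isDotProduct.Build F E (@ell2_inner R s) ell2_inner_gt0.

Let ell2_inner_norm u : ell2_inner u u = `|u| ^+ 2.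
Proof.
rewrite ell2_inner_sq [`|u|]/(ell2_norm u) expr2 -scalar_ofM -expr2.
by rewrite sqr_sqrtr ?sq_ge0.
Qed.

HB.instance Definition _ := @NormedModule_hasInner.Build R s E
  (@ell2_inner R s : {dot E for conj}) ell2_inner_norm.

End ell2_hilbert.

(** * Separability and infinite dimension of the sequence space *)

Section ell2_separable.
Context (R : realType) (s : scalar_kind).
Local Notation F := (scalar_field R s).
Local Notation E := (ell2 R s).

Definition scalar_rat : rat * rat -> F :=
  match s return rat * rat -> scalar_field R s with
  | RealScalars => fun p => ratr p.1
  | ComplexScalars => fun p => (ratr p.1 +i* ratr p.2)%C
  end.

Lemma scalar_rat_dense (z : F) (e : R) : 0 < e ->
  exists p, rnorm (z - scalar_rat p) < e.
Proof.
move=> e0.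
have rat_near (x d : R) : 0 < d -> exists q : rat, `|x - ratr q| < d.
  move=> d0; have [|q] := @rat_in_itvoo R (x - d) (x + d).
    by rewrite ltrD2l gtrN.
  by rewrite in_itv/= => /andP[h1 h2]; exists q; rewrite distrC ltr_distl h1.
rewrite /scalar_rat; move: z; case: s => z.
  by have [q zq] := rat_near z e e0; exists (q, 0).
have e20 : 0 < e / 2 by rewrite divr_gt0.
have [a za] := rat_near (complex.Re z) _ e20.
have [b zb] := rat_near (complex.Im z) _ e20.
exists (a, b); apply: le_lt_trans (complex_rnorm_le _) _.
rewrite [ltRHS]splitr ltrD//.
  by case: z za {zb}.
by case: z zb {za}.
Qed.

Lemma sqsum_tail_le (u v : nat -> F) (N n : nat) : (N <= n)%N ->
  (forall k, (N <= k)%N -> rnorm (u k) <= rnorm (v k)) ->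
  sqsum u n - sqsum u N <= sqsum v n - sqsum v N.
Proof.
move=> Nn uv; elim: n Nn => [|n IH].
  by rewrite leqn0 => /eqP ->; rewrite !subrr.
rewrite leq_eqVlt => /predU1P[->|]; first by rewrite !subrr.
rewrite ltnS => Nn; rewrite /sqsum !big_ord_recr/= -!/(sqsum _ _).
have := IH Nn; have := uv n Nn.
rewrite -(@ler_pXn2r _ 2)// ?nnegrE ?(@rnorm_ge0 R s F^o)//; lra.
Qed.

Lemma finite_support_square_summable (u : nat -> F) (N : nat) :
  (forall k, (N <= k)%N -> u k = 0) -> u \in @square_summable R s.
Proof.
move=> uN; apply/square_summableP; exists (sqsum u N) => n.
have [nN|/ltnW Nn] := leqP n N; first exact: sqsum_mono.
have h : sqsum u n - sqsum u N <= sqsum (0 : E) n - sqsum (0 : E) N.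
  by apply: sqsum_tail_le => // k Nk; rewrite uN.
have z m : sqsum (0 : E) m = 0.
  by rewrite /sqsum big1// => k _; rewrite (@rnorm0 R s F^o) expr0n.
by move: h; rewrite !z subrr subr_le0.
Qed.

Definition rat_fun (p : seq (rat * rat)) (k : nat) : F :=
  if (k < size p)%N then scalar_rat (nth (0, 0) p k) else 0.

Lemma rat_fun_square_summable p : rat_fun p \in @square_summable R s.
Proof.
apply: (@finite_support_square_summable _ (size p)) => k.
by rewrite leqNgt /rat_fun => /negbTE ->.
Qed.

Definition rat_ell2 p : E := Ell2 (rat_fun_square_summable p).

(** Finitely supported sequences with rational coordinates are dense: cut [u] where its tail
    contributes less than [d ^+ 2 / 2], then approximate the remaining coordinates so that they
    contribute at most as much. *)
Lemma ell2_separable : separable E.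
Proof.
exists (range rat_ell2).
  exact: sub_countable (card_image_le _ _) (countableP _).
move=> U [u Uu] oU.
have /nbhs_rnorm[e e0 eU] : nbhs u U by apply: open_nbhs_nbhs.
(* [rnorm_ell2_le] yields a large inequality, hence a [d] strictly below [e]. *)
pose d := e / 2; have d0 : 0 < d by rewrite divr_gt0.
have d20 : 0 < d ^+ 2 / 2 by rewrite divr_gt0// exprn_gt0.
have /cvgrPdist_lt/(_ _ d20)[N _ /(_ N (leqnn N)) uN] := @sqsum_cvg R s u.
(* The [N] first coordinates then contribute at most [N * eta ^+ 2 <= d ^+ 2 / 2]; the successor
   covers [N = 0]. *)
pose eta := Num.sqrt (d ^+ 2 / 2 / N.+1%:R).
have eta20 : 0 < d ^+ 2 / 2 / N.+1%:R by rewrite divr_gt0// ltr0Sn.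
have eta0 : 0 < eta by rewrite sqrtr_gt0.
have /choice[f fP] : forall k, exists p, rnorm (u k - scalar_rat p) < eta.
  by move=> k; exact: scalar_rat_dense.
exists (rat_ell2 (mkseq f N)); split; last by exists (mkseq f N).
apply: eU; set w := rat_ell2 _.
have wE k : (k < N)%N -> w k = scalar_rat (f k).
  by move=> kN; rewrite /= /rat_fun size_mkseq kN nth_mkseq.
have w0 k : (N <= k)%N -> w k = 0.
  by move=> kN; rewrite /= /rat_fun size_mkseq ltnNge kN.
have headN : sqsum (u - w : E) N <= d ^+ 2 / 2.
  apply: (@le_trans _ _ (\sum_(k < N) eta ^+ 2)).
    apply: ler_sum => k _; rewrite ell2B wE//.
    by rewrite ler_pXn2r ?nnegrE ?(@rnorm_ge0 R s F^o) ?ltW.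
  rewrite sumr_const card_ord sqr_sqrtr; last exact: ltW.
  rewrite -[leLHS]mulr_natr [leLHS]mulrAC ler_pdivrMr ?ltr0Sn// ler_wpM2l ?ler_nat//.
  exact: ltW.
apply: (@le_lt_trans _ _ d); last by rewrite /d ltr_pdivrMr// ltr_pMr// ltr1n.
apply: rnorm_ell2_le => [|n]; first exact: ltW.
have [nN|/ltnW Nn] := leqP n N.
  apply: le_trans (sqsum_mono _ nN) _; apply: le_trans headN _.
  by rewrite ler_pdivrMr// ler_peMr ?sqr_ge0// ler1n.
have tail k : (N <= k)%N -> rnorm ((u - w : E) k) <= rnorm (u k).
  by move=> Nk; rewrite ell2B w0// subr0.
have := sqsum_tail_le Nn tail.
have : sqsum u n <= limn (sqsum u).
  by apply: nondecreasing_cvgn_le; [exact: sqsum_mono|exact: sqsum_cvg].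
move: uN; rewrite /= ltr_norml => /andP[_ h1] h2 h3.
lra.
Qed.

Definition ell2_basis_fun (i k : nat) : F := (k == i)%:R.

Lemma ell2_basis_square_summable i : ell2_basis_fun i \in @square_summable R s.
Proof.
apply: (@finite_support_square_summable _ i.+1) => k ik.
by rewrite /ell2_basis_fun gtn_eqF.
Qed.

Definition ell2_basis i : E := Ell2 (ell2_basis_square_summable i).

Lemma inner_ell2_basis i (v : E) : '<[ell2_basis i, v]> = scalar_conj (v i).
Proof.
apply/cvg_lim; first exact: (@norm_hausdorff F F^o).
apply: cvg_near_cst; exists i.+1 => //= n /= ni.
rewrite /inner_psum (bigD1 (Ordinal ni))//= /ell2_basis_fun eqxx mul1r big1 ?addr0//.
by move=> k /eqP ki; case: eqP => [ki'|_]; [case: ki; exact: val_inj|rewrite mul0r].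
Qed.

(** One more unit vector than a generating sequence has terms contradicts [orthonormal_seq_size]. *)
Lemma ell2_infinite_dim : ~ finite_dim E.
Proof.
move=> /finite_dim_seq[r rT].
pose o := [seq ell2_basis i | i <- iota 0 (size r).+1].
suff /orthonormal_seq_size/(_ rT) : orthonormal_seq o.
  by rewrite size_map size_iota ltnn.
have bb i j : '<[ell2_basis i, ell2_basis j]> = (i == j)%:R.
  rewrite inner_ell2_basis /= /ell2_basis_fun; case: eqP => _.
    by rewrite scalar_conj_ge0.
  exact: scalar_conj0.
have b_inj : injective ell2_basis.
  move=> i j ij; have := bb i j; rewrite ij bb eqxx.
  by case: eqP => // _ /eqP; rewrite oner_eq0.
split; first by rewrite map_inj_uniq// iota_uniq.
by move=> _ _ /mapP[i _ ->] /mapP[j _ ->]; rewrite bb (inj_eq b_inj).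
Qed.

End ell2_separable.

(** * The constant identity kernel *)

Section identity_kernel.
Context (R : realType) (s : scalar_kind) (Y : hilbertType R s).

Definition id_clin : clin Y := @CLin R s Y idfun (fun x => @cvg_id _ (nbhs x)).

Lemma id_clin_trace_class_finite_dim B : orthonormal_basis B ->
  (abs_diag_sum id_clin B < +oo)%E -> finite_dim Y.
Proof.
move=> Bb Bfin; have [/finite_seqP[r Br]|infB] := pselect (finite_set B).
  have Bu : B = [set` undup r].
    by rewrite Br; apply/seteqP; split=> b; rewrite /= mem_undup.
  exists B; first by rewrite Br; apply/finite_seqP; exists r.
  have oo : orthonormal_seq (undup r).
    by apply: orthonormal_basis_seq Bb (undup_uniq r) _; rewrite Bu.
  by rewrite Bu; apply: lspan_orthonormal_dense => //; case: Bb => _ _; rewrite Bu.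
have S0 := abs_diag_sum_ge0 id_clin B.
case: (abs_diag_sum id_clin B) (@abs_diag_sum_ge _ _ _ id_clin B) S0 Bfin => // t tB t0 _.
(* Every diagonal entry is 1, so a part of [B] with more than [t] vectors has a partial sum above
   [t]. *)
have [D DB nD] := infinite_set_fset (Num.bound t) infB.
have := tB _ (finmap.fset_uniq D) DB; rewrite lee_fin.
rewrite big_seq (eq_bigr (fun=> 1)) => [|b /DB bB].
  rewrite -big_seq big_const_seq count_predT iter_addr_0 leNgt.
  rewrite (lt_le_trans (archi_boundP _))//.
  by rewrite ler_nat.
by have [B1 _ _] := Bb; rewrite /= B1// scalar_re1.
Qed.

Lemma opnorm_id_clin : (opnorm id_clin <= 1)%E.
Proof. by apply: ge_ereal_sup => _ [y y1 <-]; rewrite lee_fin. Qed.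

(** The evaluation map of the counterexample: the space of the identity kernel consists of the
    constant functions and is a copy of [Y]. *)
Definition const_fun (X : Type) (y : Y) : X -> Y := fun=> y.

HB.instance Definition _ (X : Type) :=
  @GRing.isLinear.Build (scalar_field R s) Y (X -> Y) *:%R (@const_fun X)
  (fun _ _ _ => erefl).

Lemma polish_real : polish R R^o.
Proof.
split.
  exists (range ratr); last exact: dense_rat.
  exact: sub_countable (card_image_le _ _) (countableP _).
exists R^o, id, id; split => //.
- by move=> x; exact: cvg_id.
- by move=> x; exact: cvg_id.
- by move=> G PG /R_complete/cvg_ex.
Qed.

(** Each [y] represents itself in the reproducing property, and the double sum of positivity is the
    squared norm of the sum of the [y k]. The point of [X] makes the evaluation map injective. *)
Lemma const_rkhs (X : topologicalType) : polish R X -> X -> separable Y ->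
  is_rkhs (@const_fun X) (fun _ _ : X => id_clin).
Proof.
move=> pX x0 sY; split => //.
- by move=> u v /(congr1 (@^~ x0)).
- by move=> x y; exists y.
- move=> n x y; under eq_bigr do rewrite -inner_suml.
  by rewrite -inner_sumr inner_ge0.
Qed.

End identity_kernel.

Theorem mainTheorem6 (R : realType) (s : scalar_kind) :
  [/\ forall (X : topologicalType) (Y H : hilbertType R s)
        (ev : {linear H -> (X -> Y)}) (K : X -> X -> clin Y),
        is_rkhs ev K -> bounded_trace_kernel K -> bounded_kernel K,
      forall (X : topologicalType) (Y H : hilbertType R s)
        (ev : {linear H -> (X -> Y)}) (K : X -> X -> clin Y),
        is_rkhs ev K -> finite_dim Y ->
        (bounded_kernel K <-> bounded_trace_kernel K) &
      exists (X : topologicalType) (Y H : hilbertType R s)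
        (ev : {linear H -> (X -> Y)}) (K : X -> X -> clin Y),
        [/\ is_rkhs ev K, ~ finite_dim Y, bounded_kernel K &
            ~ bounded_trace_kernel K]].
Proof.
split.
- by move=> X Y H ev K rkhsK; exact: bounded_trace_kernel_bounded rkhsK.
- move=> X Y H ev K rkhsK fY; split; first exact: finite_dim_bounded_trace_kernel fY.
  exact: bounded_trace_kernel_bounded rkhsK.
(* Any nonempty Polish space could replace the real line here. *)
exists R^o, (ell2 R s), (ell2 R s), (@const_fun R s (ell2 R s) R^o).
exists (fun _ _ => id_clin (ell2 R s)); split.
- apply: const_rkhs 0 _; [exact: polish_real|exact: ell2_separable].
- exact: ell2_infinite_dim.
- exists 1 => // x; rewrite expr1n; exact: opnorm_id_clin.
move=> [/(_ 0)[B Bb [_ Bfin]] _].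
exact: ell2_infinite_dim (id_clin_trace_class_finite_dim Bb Bfin).
Qed.
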